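(* Let $A=(a_1,\dots,a_n)$ be a configuration of points affinely spanning $\mathbb{R}^d$, let $\mathcal{P}(h)$ be a regular fine zonotopal tiling of $Z(V)$ with generic height function $h$, let $x\in\mathrm{conv}(A)$ be a generic point, and let $\Pi_{\varnothing,Z}$ be the only tile in $\mathcal{P}^{(0)}(h)=\{\Pi_{I,B}\in\mathcal{P}(h):I=\varnothing\}$ supported on $x$. Then for every tile $\Pi_{I',B'}\in\mathcal{P}(h)$ supported on $x$, there is a directed path in $(\mathcal{G},o_x)$ from $\Pi_{\varnothing,Z}$ to $\Pi_{I',B'}$ such that every tile $\Pi_{I,B}$ in the path satisfies $|I|\le|I'|$.
   Context: Notation: $[n]=\{1,\dots,n\}$, $|\cdot|$ is cardinality, $\sqcup$ is disjoint union, $d\ge1$. The configuration $A$ is indexed by $[n]$; repeated points and affine dependencies are allowed. Zonotope and tilings: $v_i=(a_i,1)\in\mathbb{R}^{d+1}$, $V=(v_1,\dots,v_n)$, and $Z(V)=\sum_{i=1}^n[0,v_i]$ (Minkowski sum). For disjoint $I,B\subseteq[n]$ with $|B|=d+1$ and $(a_b)_{b\in B}$ affinely independent, the tile is $\Pi_{I,B}=\sum_{i\in I}v_i+\sum_{b\in B}[0,v_b]$. Its facets are $\Pi_{J,C}=\sum_{j\in J}v_j+\sum_{c\in C}[0,v_c]$ with $C=B\setminus\{b\}$ for some $b\in B$ and $J\in\{I,I\sqcup\{b\}\}$. Tiles and faces are labelled by their index pairs. A fine zonotopal tiling of $Z(V)$ is a collection of such tiles forming a polyhedral subdivision of $Z(V)$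 (tiles cover $Z(V)$, have pairwise disjoint interiors, and intersect in common labelled faces). Every facet of a tile is either internal (shared by exactly two tiles) or lies on the boundary of $Z(V)$. Height functions: a height function assigns a real number $h(a_i)$ to each index $i\in[n]$. It is generic if, in the lifted configuration $((a_i,h(a_i)))_{i\in[n]}\subset\mathbb{R}^{d+1}$, the only affinely dependent subsets of $d+2$ points lie on a vertical hyperplane (normal $N$ with $N_{d+1}=0$). The regular fine zonotopal tiling $\mathcal{P}(h)$ has exactly one tile $\Pi_{I,B}$ for each $B\subseteq[n]$ with $|B|=d+1$ and $(a_b)_{b\in B}$ affinely independent; ordering $B$ so that $\det((a_b,1)_{b\in B})>0$, the set $I$ consists of the $i\in[n]\setminus B$ with $\det((a_b,h(a_b),1)_{b\in B},(a_i,h(a_i),1))>0$ (this determinant is negative for the remaining $i\notin I\sqcup B$). A tile $\Pi_{I,B}$ is supported on $x$ if $x\in\mathrm{conv}(\{a_i\}_{i\in I\sqcup B})$. A point $x\in\mathbb{R}^d$ is generic if $x\notin\mathrm{aff}(\{a_c\}_{c\in C})$ for all internal facets $\Pi_{J,C}$ of the tiling. Oriented adjacency graph: $\mathcal{G}$ is the graph with the tiles of $\mathcal{P}(h)$ as vertices, two tiles being joined by an edge iff they share a facet. For a generic $x$, the orientation $o_x$ directs the edge between $\Pi_{I,B}$ and $\Pi_{I',B'}$ sharing the facet $\Pi_{J,C}$, with normal vector $N_C\in\mathbb{R}^{d+1}$, as $\Pi_{I,B}\to\Pi_{I',B'}$ iff $\mathrm{sign}\langle N_C,(x,1)\rangle=\mathrm{sign}\langle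 N_C,z'-z\rangle$ for any interior points $z'\in\Pi_{I',B'}$, $z\in\Pi_{I,B}$. *)

(* Defs.v *)
From mathcomp Require Import all_boot all_order all_algebra.
From mathcomp Require Import boolp classical_sets reals topology normedtype.

Set Implicit Arguments.
Unset Strict Implicit.
Unset Printing Implicit Defensive.

Import Order.TTheory GRing.Theory Num.Theory.
Import numFieldNormedType.Exports.

Local Open Scope ring_scope.

Section AffineGeometry.

Variable R : realType.

Definition dot m (u v : 'rV[R]_m) : R := \sum_i u 0 i * v 0 i.

(* Configurations are indexed families: repeated points count as different
   elements, so two equal points are affinely dependent. *)
Definition aff_hull m n (p : 'I_n -> 'rV[R]_m) (S : {set 'I_n})
    (y : 'rV[R]_m) : Prop :=
  exists c : 'I_n -> R,
    \sum_(i in S) c i = 1 /\ y = \sum_(i in S) c i *: p i.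

Definition conv_hull m n (p : 'I_n -> 'rV[R]_m) (S : {set 'I_n})
    (y : 'rV[R]_m) : Prop :=
  exists c : 'I_n -> R,
    [/\ forall i, i \in S -> 0 <= c i,
        \sum_(i in S) c i = 1 & y = \sum_(i in S) c i *: p i].

Definition aff_dependent m n (p : 'I_n -> 'rV[R]_m) (S : {set 'I_n}) : Prop :=
  exists c : 'I_n -> R,
    [/\ exists2 i, i \in S & c i != 0,
        \sum_(i in S) c i = 0 & \sum_(i in S) c i *: p i = 0].

Definition aff_spanning m n (p : 'I_n -> 'rV[R]_m) : Prop :=
  forall y, aff_hull p [set: 'I_n] y.

Definition homog m (u : 'rV[R]_m) : 'rV[R]_(m + 1) := row_mx u 1%:M.

End AffineGeometry.

Section Tiling.

Variables (R : realType) (d n : nat).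
Variables (a : 'I_n -> 'rV[R]_d) (h : 'I_n -> R).

Definition lifted (i : 'I_n) : 'rV[R]_(d + 1) := row_mx (a i) (h i)%:M.

Definition on_vertical_hyperplane (S : {set 'I_n}) : Prop :=
  exists (N : 'rV[R]_(d + 1)) (c : R),
    [/\ N != 0, N 0 (rshift d ord0) = 0 &
        forall i, i \in S -> dot N (lifted i) = c].

Definition generic_height : Prop :=
  forall S : {set 'I_n}, #|S| = d.+2 ->
    aff_dependent lifted S -> on_vertical_hyperplane S.

(* The pair (I, B) is the label of the tile or face Pi_{I,B}. *)
Definition label : Type := ({set 'I_n} * {set 'I_n})%type.

Definition is_tile (s : label) : Prop :=
  [/\ [disjoint s.1 & s.2], #|s.2| = d.+1 & ~ aff_dependent a s.2].

Definition zonotope_tile (s : label) : set 'rV[R]_(d + 1) :=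
  (fun z => exists2 c : 'I_n -> R,
     forall b, b \in s.2 -> 0 <= c b <= 1 &
     z = \sum_(i in s.1) homog (a i) + \sum_(b in s.2) c b *: homog (a b)).

Definition basis_mx (f : 'I_(d + 1) -> 'I_n) : 'M[R]_(d + 1) :=
  \matrix_k homog (a (f k)).

Definition lifted_mx (f : 'I_(d + 1) -> 'I_n) (i : 'I_n) :
    'M[R]_(d + 1 + 1) :=
  col_mx (\matrix_k homog (lifted (f k))) (homog (lifted i)).

(* f is an ordering of B; it is injective because its determinant is nonzero,
   and the resulting I does not depend on the choice of f. *)
Definition regular_tiling : {set label} :=
  [set s | `[< is_tile s /\
     exists f : 'I_(d + 1) -> 'I_n,
       [/\ s.2 = [set f k | k : 'I_(d + 1)],
           0 < \det (basis_mx f) &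
           s.1 = [set i | (i \notin s.2) && (0 < \det (lifted_mx f i))]] >]].

Definition regular_tiling0 : {set label} :=
  [set s in regular_tiling | s.1 == finset.set0].

Definition is_facet (F s : label) : bool :=
  [exists b in s.2,
     (F.2 == s.2 :\ b) && ((F.1 == s.1) || (F.1 == b |: s.1))].

Definition internal_facet (F : label) : Prop :=
  #|[set s in regular_tiling | is_facet F s]| = 2.

Definition supported (x : 'rV[R]_d) (s : label) : Prop :=
  conv_hull a (s.1 :|: s.2) x.

Definition generic_point (x : 'rV[R]_d) : Prop :=
  forall F, internal_facet F -> ~ aff_hull a F.2 x.

Definition adjacent (s t : label) : Prop :=
  [/\ s \in regular_tiling, t \in regular_tiling, s != t &
      exists F, is_facet F s && is_facet F t].

Definition facet_normal (F : label) (N : 'rV[R]_(d + 1)) : Prop :=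
  N != 0 /\ forall c, c \in F.2 -> dot N (homog (a c)) = 0.

(* N_C is only defined up to a nonzero scalar, which does not affect the
   comparison of signs. *)
Definition arrow (x : 'rV[R]_d) (s t : label) : Prop :=
  adjacent s t /\
  forall F N, is_facet F s -> is_facet F t -> facet_normal F N ->
  forall z z', interior (zonotope_tile s) z -> interior (zonotope_tile t) z' ->
    Num.sg (dot N (homog x)) = Num.sg (dot N (z' - z)).

(* s :: p is a simple directed path from s to t. *)
Definition directed_path (x : 'rV[R]_d) (s : label) (p : seq label)
    (t : label) : Prop :=
  [/\ path (fun u v => `[< arrow x u v >]) s p, uniq (s :: p) & last s p = t].

End Tiling.

(* Main.v *)
Require Import Defs.
From mathcomp Require Import boolp classical_sets filter topology normedtype.
From mathcomp Require Import all_boot all_order all_algebra.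
From mathcomp Require Import perm reals ring lra.

(* Write v_i = (a_i, 1), and let X = (x, 1).  In the space of linear forms g, the
   tile (I, B) is the vertex g_B of the arrangement of the hyperplanes
   g(v_i) = h_i with g_B(v_b) = h_b for b in B and I = {i : h_i < g_B(v_i)}.
   Tiles sharing a facet are vertices joined by an edge of the arrangement, and
   o_x orients edges towards increasing g(X).  The path is built backwards from
   (I', B').  If (I, B) is supported on x and I is nonempty, pushing the weights
   of a convex combination representing x from B to I until one of them vanishes
   yields b in B with positive barycentric coordinate at x and
   x in conv(I u B \ b).  Decreasing g(v_b) with B \ b kept tight leads to a tile
   that loses only b from I u B, hence is still supported on x, has no more
   elements in I, and has smaller g(X).  The walk stops at a tile with empty I;
   such a tile maximizes g(X) subject to g(v_i) <= h_i for all i, and by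
   genericity of x this linear program has a unique optimal vertex. *)

Section Tilings.
Set Implicit Arguments.
Unset Strict Implicit.
Unset Printing Implicit Defensive.
Import Order.TTheory GRing.Theory Num.Theory numFieldNormedType.Exports.
Local Open Scope ring_scope.

(** * The dot product and homogeneous coordinates *)

Lemma dotE (R : realType) m (u v : 'rV[R]_m) : dot u v = (u *m v^T) 0 0.
Proof. by rewrite mxE; apply: eq_bigr => i _; rewrite mxE. Qed.

Lemma dotC (R : realType) m (u v : 'rV[R]_m) : dot u v = dot v u.
Proof. by apply: eq_bigr => i _; rewrite mulrC. Qed.

Lemma dotDr (R : realType) m (u v w : 'rV[R]_m) :
  dot u (v + w) = dot u v + dot u w.
Proof. by rewrite !dotE linearD mulmxDr mxE. Qed.

Lemma dotZr (R : realType) m (u v : 'rV[R]_m) k : dot u (k *: v) = k * dot u v.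
Proof. by rewrite !dotE linearZ -scalemxAr mxE. Qed.

Lemma dotDl (R : realType) m (u v w : 'rV[R]_m) :
  dot (u + v) w = dot u w + dot v w.
Proof. by rewrite dotC dotDr !(dotC w). Qed.

Lemma dotZl (R : realType) m (u v : 'rV[R]_m) k : dot (k *: u) v = k * dot u v.
Proof. by rewrite dotC dotZr dotC. Qed.

Lemma dot0l (R : realType) m (v : 'rV[R]_m) : dot 0 v = 0.
Proof. by rewrite -(scale0r 0) dotZl mul0r. Qed.

Lemma dot0r (R : realType) m (v : 'rV[R]_m) : dot v 0 = 0.
Proof. by rewrite dotC dot0l. Qed.

Lemma dotNl (R : realType) m (u v : 'rV[R]_m) : dot (- u) v = - dot u v.
Proof. by rewrite -scaleN1r dotZl mulN1r. Qed.

Lemma dotNr (R : realType) m (u v : 'rV[R]_m) : dot u (- v) = - dot u v.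
Proof. by rewrite dotC dotNl dotC. Qed.

Lemma dot_sumr (R : realType) m (u : 'rV[R]_m) (I : finType) (P : pred I)
    (w : I -> 'rV[R]_m) :
  dot u (\sum_(i | P i) w i) = \sum_(i | P i) dot u (w i).
Proof.
rewrite dotE raddf_sum mulmx_sumr summxE.
by apply: eq_bigr => i _; rewrite -dotE.
Qed.

Lemma dot_row_mx (R : realType) m1 m2 (u1 v1 : 'rV[R]_m1) (u2 v2 : 'rV[R]_m2) :
  dot (row_mx u1 u2) (row_mx v1 v2) = dot u1 v1 + dot u2 v2.
Proof. by rewrite !dotE tr_row_mx mul_row_col mxE. Qed.

Lemma dot_eq0 (R : realType) m (u : 'rV[R]_m) : (forall v, dot u v = 0) -> u = 0.
Proof.
move=> hu; apply/rowP => i; rewrite mxE.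
have := hu (delta_mx 0 i); rewrite /dot (bigD1 i) //= mxE !eqxx mulr1 big1.
  by rewrite addr0.
by move=> j ji; rewrite mxE (negPf ji) andbF mulr0.
Qed.

(** Homogenizing packs the condition on the weights and the vector equation into one linear
    equation, so affine questions become linear ones. *)
Lemma homog_sum (R : realType) m n (p : 'I_n -> 'rV[R]_m) (S : {set 'I_n})
    (c : 'I_n -> R) y :
  homog y = \sum_(i in S) c i *: homog (p i) <->
  \sum_(i in S) c i = 1 /\ y = \sum_(i in S) c i *: p i.
Proof.
have -> : \sum_(i in S) c i *: homog (p i) =
    row_mx (\sum_(i in S) c i *: p i) (\sum_(i in S) c i)%:M.
  apply: (big_rec3 (fun u v w => w = row_mx u v%:M)).
    by rewrite raddf0 row_mx0.
  move=> i u v w _ ->.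
  by rewrite scale_row_mx add_row_mx scale_scalar_mx mulr1 raddfD.
split=> [/eq_row_mx[-> /matrixP/(_ 0 0)]|[-> <-]//].
by rewrite !mxE eqxx !mulr1n.
Qed.

Lemma conv_hullP (R : realType) m n (p : 'I_n -> 'rV[R]_m) (S : {set 'I_n}) y :
  conv_hull p S y <-> exists c : 'I_n -> R, (forall i, i \in S -> 0 <= c i) /\
    homog y = \sum_(i in S) c i *: homog (p i).
Proof.
split=> [[c [c0 c1 yE]]|[c [c0 /homog_sum[c1 yE]]]]; exists c; split=> //.
exact/homog_sum.
Qed.

Lemma conv_hullS (R : realType) m n (p : 'I_n -> 'rV[R]_m) (S T : {set 'I_n}) y :
  S \subset T -> conv_hull p S y -> conv_hull p T y.
Proof.
move=> ST /conv_hullP[c [c0 yE]]; apply/conv_hullP.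
exists (fun i => if i \in S then c i else 0); split=> [i _|].
  by case: ifP => // /c0.
rewrite yE [RHS]big_mkcond [LHS]big_mkcond /=; apply: eq_bigr => i _.
have [iS|_] := boolP (i \in S); first by rewrite (subsetP ST).
by rewrite scale0r if_same.
Qed.

Lemma spanning_dot (R : realType) m n (p : 'I_n -> 'rV[R]_m) (u : 'rV_(m + 1)) :
  aff_spanning p -> (forall i, dot u (homog (p i)) = 0) -> u = 0.
Proof.
move=> spanp up.
have uh y : dot u (homog y) = 0.
  have [c /homog_sum ->] := spanp y.
  by rewrite dot_sumr big1 // => i _; rewrite dotZr up mulr0.
rewrite -(hsubmxK u) in uh *; set u1 := lsubmx u in uh *; set u2 := rsubmx u in uh *.
have du2 : dot u2 1%:M = 0.
  by have := uh 0; rewrite dot_row_mx dotE trmx0 mulmx0 mxE add0r.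
have -> : u1 = 0 by apply: dot_eq0 => y; have := uh y; rewrite dot_row_mx du2 addr0.
suff -> : u2 = 0 by rewrite row_mx0.
apply/rowP => i; rewrite (ord1 i) mxE.
by move: du2; rewrite /dot big_ord1 !mxE mulr1.
Qed.

(* The ratio test: moving along a line at rate [r], the first of the finitely
   many constraints [s j - t * r j >= 0] that becomes tight. *)
Lemma ratio_test (R : realType) (I : finType) (P : pred I) (s r : I -> R) :
  (forall j, P j -> 0 <= s j) -> (exists2 i, P i & 0 < r i) ->
  exists i, exists t, [/\ P i, 0 < r i, 0 <= t, s i = t * r i &
    forall j, P j -> 0 <= s j - t * r j].
Proof.
move=> s0 [i0 Pi0 ri0].
pose Q := [pred i | P i && (0 < r i)].
have Qi0 : Q i0 by rewrite /= Pi0.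
case: (Order.TotalTheory.arg_minP (fun i => s i / r i) Qi0) => i /andP[Pi ri] imin.
exists i, (s i / r i); split=> //.
- by rewrite divr_ge0 ?s0 // ltW.
- by rewrite divfK ?gt_eqF.
move=> j Pj; have [rj|rj] := ltP 0 (r j).
  rewrite subr_ge0 -ler_pdivlMr //; apply: imin; exact/andP.
by rewrite subr_ge0 (le_trans _ (s0 _ Pj)) // mulr_ge0_le0 // divr_ge0 ?s0 // ltW.
Qed.

(** * Bases, dual bases and exchange *)

Section LinearBases.
Variables (R : realType) (m n : nat) (v : 'I_n -> 'rV[R]_m).

(** Spanning is encoded dually, as triviality of the annihilator; this is the form in which a vertex
    is determined by its tight hyperplanes. *)
Definition lin_basis (B : {set 'I_n}) : Prop :=
  #|B| = m /\ forall u, (forall b, b \in B -> dot u (v b) = 0) -> u = 0.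

(** When [v i] is [homog (a i)], the numbers [dot (E b) (homog y)] are the barycentric coordinates
    of [y]. *)
Definition dual_basis (B : {set 'I_n}) (E : 'I_n -> 'rV[R]_m) : Prop :=
  {in B &, forall b c, dot (E b) (v c) = (b == c)%:R} /\
  forall y, y = \sum_(b in B) dot (E b) y *: v b.

Lemma lin_basis_dot_inj (B : {set 'I_n}) (g g' : 'rV[R]_m) : lin_basis B ->
  {in B, forall b, dot g (v b) = dot g' (v b)} -> g = g'.
Proof.
move=> [_ sB] gg'; apply/eqP; rewrite -subr_eq0; apply/eqP; apply: sB => b bB.
by rewrite dotDl dotNl gg' // subrr.
Qed.

Lemma lin_basis_enum (B : {set 'I_n}) : lin_basis B ->
  exists f : 'I_m -> 'I_n, [/\ injective f, B = [set f k | k : 'I_m] &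
    (\matrix_k v (f k)) \in unitmx].
Proof.
case=> cB spanB.
pose f (k : 'I_m) := enum_val (cast_ord (esym cB) k).
have fB : B = [set f k | k : 'I_m].
  apply/setP => i; apply/idP/imsetP => [iB|[k _ ->]]; last exact: enum_valP.
  exists (cast_ord cB (enum_rank_in iB i)) => //.
  by rewrite /f cast_ordK enum_rankK_in.
exists f; split=> //; first by move=> j k /enum_val_inj/cast_ord_inj.
(* Each column of the cokernel annihilates every [v b], hence vanishes. *)
rewrite -row_full_unit -cokermx_eq0; apply/eqP/matrixP => i j.
pose u := (col j (cokermx (\matrix_k v (f k))))^T.
suff /rowP/(_ i) : u = 0 by rewrite !mxE.
apply: spanB => b; rewrite fB => /imsetP[k _ ->].
have /matrixP/(_ k j) := mulmx_coker (\matrix_k v (f k)).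
rewrite [RHS]mxE => <-; rewrite dotC mxE; apply: eq_bigr => l _.
by rewrite !mxE.
Qed.

Lemma unit_lin_basis (f : 'I_m -> 'I_n) : (\matrix_k v (f k)) \in unitmx ->
  injective f /\ lin_basis [set f k | k : 'I_m].
Proof.
set M := \matrix_k _ => uM.
have fI : injective f.
  move=> i j fij; have [//|ij] := eqVneq i j.
  have : (M *m invmx M) i i = (M *m invmx M) j i.
    by rewrite !mxE; apply: eq_bigr => k _; rewrite !mxE fij.
  by rewrite mulmxV // !mxE eqxx eq_sym (negPf ij) => /eqP; rewrite oner_eq0.
split=> //; split; first by rewrite card_imset // card_ord.
move=> u ub; apply: trmx_inj; rewrite trmx0 -[u^T](mulKmx uM).
suff -> : M *m u^T = 0 by rewrite mulmx0.
apply/matrixP => k j; rewrite [RHS]mxE -(ub (f k)) ?imset_f // dotC mxE (ord1 j).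
by apply: eq_bigr => l _; rewrite !mxE.
Qed.

Lemma dual_basis_exists B : lin_basis B -> exists E, dual_basis B E.
Proof.
move=> bB; have [f [fI BE uM]] := lin_basis_enum bB.
pose M := \matrix_k v (f k).
(* The dual vectors are the columns of the inverse matrix; the value 0 outside [B] is a default. *)
pose E i := if [pick k | f k == i] is Some k then (col k (invmx M))^T else 0.
have Ef k : E (f k) = (col k (invmx M))^T.
  by rewrite /E; case: pickP => [l /eqP/fI ->//|/(_ k)]; rewrite eqxx.
have dE b c : b \in B -> c \in B -> dot (E b) (v c) = (b == c)%:R.
  rewrite BE => /imsetP[k _ ->] /imsetP[l _ ->]; rewrite Ef (inj_eq fI) eq_sym.
  have /matrixP/(_ l k) := mulmxV uM; rewrite [RHS]mxE => <-.
  by rewrite dotC mxE; apply: eq_bigr => j _; rewrite !mxE.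
exists E; split=> // y; apply/eqP; rewrite -subr_eq0; apply/eqP.
suff : (y - \sum_(b in B) dot (E b) y *: v b) *m invmx M = 0.
  by move/(congr1 (mulmxr M)); rewrite /= mulmxKV // mul0mx.
apply/rowP => k; rewrite [RHS]mxE.
have kE w : (w *m invmx M) 0 k = dot (E (f k)) w.
  by rewrite Ef dotC mxE; apply: eq_bigr => j _; rewrite !mxE.
have fkB : f k \in B by rewrite BE imset_f.
rewrite kE dotDr dotNr dot_sumr (bigD1 (f k)) //= big1 ?addr0.
  by rewrite dotZr dE // eqxx mulr1 subrr.
by move=> b /andP[bB' bk]; rewrite dotZr dE // eq_sym (negPf bk) mulr0.
Qed.

Lemma dual_basis_coord B E b (y : 'I_n -> R) : dual_basis B E -> b \in B ->
  dot (E b) (\sum_(j in B) y j *: v j) = y b.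
Proof.
move=> [dE _] bB; rewrite dot_sumr (bigD1 b) //= dotZr dE // eqxx mulr1.
rewrite big1 ?addr0 // => j /andP[jB jb].
by rewrite dotZr dE // eq_sym (negPf jb) mulr0.
Qed.

(** The annihilator of [B :\ b] is the line spanned by [u], and a multiple of [u] that vanishes at
    [v i] is zero. *)
Lemma lin_basis_exchange B b i (u : 'rV[R]_m) : lin_basis B -> b \in B ->
  (forall c, c \in B :\ b -> dot u (v c) = 0) -> dot u (v i) != 0 ->
  lin_basis (i |: B :\ b).
Proof.
move=> [cB sB] bB uC ui.
have iC : i \notin B :\ b by apply: contraNN ui => /uC ->.
have ub : dot u (v b) != 0.
  apply: contraNN ui => /eqP ub; rewrite (sB u) => [|c cB'].
    by rewrite dot0l.
  by have [->//|cb] := eqVneq c b; apply: uC; rewrite !inE cb.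
split=> [|w wC]; first by rewrite cardsU1 iC -cB (cardsD1 b B) bB.
have wE : w = (dot w (v b) / dot u (v b)) *: u.
  apply/eqP; rewrite -subr_eq0; apply/eqP; apply: sB => c cB'.
  rewrite dotDl dotNl dotZl; have [->|cb] := eqVneq c b.
    by rewrite divfK // subrr.
  have cC : c \in B :\ b by rewrite in_setD1 cb.
  by rewrite (wC c) ?(uC c) ?mulr0 ?subrr // in_setU cC orbT.
have := wC i (setU11 _ _); rewrite wE dotZl => /eqP.
by rewrite mulf_eq0 (negPf ui) orbF => /eqP ->; rewrite scale0r.
Qed.

End LinearBases.

(** * Tiles as vertices of the hyperplane arrangement *)

Section Vertices.
Variables (R : realType) (d n : nat) (a : 'I_n -> 'rV[R]_d) (h : 'I_n -> R).

Local Notation v i := (homog (a i)).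
Local Notation basis := (lin_basis (fun i => v i)).

(* Tiles are dual to the vertices of the arrangement of the hyperplanes
   [dot g (v i) = h i] in the space of linear forms [g]: the set [s.2] consists
   of the hyperplanes through the vertex, and [s.1] of those below it. *)
Definition vertex (s : label n) (g : 'rV[R]_(d + 1)) : Prop :=
  [/\ basis s.2, {in s.2, forall b, dot g (v b) = h b} &
      s.1 = [set i | h i < dot g (v i)]].

Lemma interpolation (B : {set 'I_n}) : basis B ->
  exists g, {in B, forall b, dot g (v b) = h b}.
Proof.
move=> /dual_basis_exists[E [dE _]].
exists (\sum_(b in B) h b *: E b) => c cB.
rewrite dotC dot_sumr (bigD1 c) //= big1 => [|b /andP[bB bc]].
  by rewrite dotZr dotC dE // eqxx mulr1 addr0.
by rewrite dotZr dotC dE // (negPf bc) mulr0.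
Qed.

(** Subtracting from the height column the combination of the other columns given by [g] leaves only
    [h i - dot g (v i)], in the last row. The lifted rows end in height and then 1, so one column
    swap changes the sign. Thus the determinant test for [I] asks on which side of hyperplane [i]
    the vertex lies. *)
Lemma det_lifted_mx (f : 'I_(d + 1) -> 'I_n) g i :
  (forall k, dot g (v (f k)) = h (f k)) ->
  \det (lifted_mx a h f i) = \det (basis_mx a f) * (dot g (v i) - h i).
Proof.
move=> gf.
pose j1 : 'I_(d + 1 + 1) := lshift 1 (rshift d ord0).
pose j2 : 'I_(d + 1 + 1) := rshift (d + 1) ord0.
pose M := block_mx (basis_mx a f) 0 (v i) (h i - dot g (v i))%:M.
pose U := block_mx 1%:M g^T 0 (1%:M : 'M_1).
have j12 : j1 != j2 by rewrite eq_lrshift.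
have -> : lifted_mx a h f i = xcol j1 j2 (M *m U).
  rewrite /M /U mulmx_block !mulmx1 !mulmx0 !addr0.
  apply/matrixP => k l; rewrite /lifted_mx /xcol [RHS]mxE.
  have gE j : (v j *m g^T) 0 0 = dot g (v j) by rewrite -dotE dotC.
  case: (split_ordP l) => [l' ->|l' ->]; last first.
    rewrite (ord1 l') tpermR /j1.
    case: (split_ordP k) => [k' ->|k' ->].
      by rewrite col_mxEu block_mxEul mxE [RHS]mxE /homog !row_mxEr.
    by rewrite col_mxEd block_mxEdl /homog (ord1 k') !row_mxEr.
  case: (split_ordP l') => [l'' ->|l'' ->].
    have -> : tperm j1 j2 (lshift 1 (lshift 1 l'')) = lshift 1 (lshift 1 l'').
      by rewrite tpermD // ?eq_rlshift // eq_lshift eq_rlshift.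
    case: (split_ordP k) => [k' ->|k' ->].
      rewrite col_mxEu block_mxEul mxE [RHS]mxE.
      by rewrite /homog row_mxEl /lifted !row_mxEl.
    by rewrite col_mxEd block_mxEdl /homog (ord1 k') !row_mxEl.
  rewrite (ord1 l'') tpermL /j2.
  case: (split_ordP k) => [k' ->|k' ->].
    rewrite col_mxEu block_mxEur mxE /homog row_mxEl /lifted !row_mxEr.
    rewrite !mxE eqxx mulr1n -gf /dot; apply: eq_bigr => j _.
    by rewrite !mxE mulrC.
  rewrite col_mxEd block_mxEdr /homog (ord1 k') !row_mxEl /lifted !row_mxEr.
  by rewrite [RHS]mxE gE !mxE eqxx !mulr1n addrC subrK.
rewrite xcolE !det_mulmx det_lblock det_ublock !det1 det_scalar1 det_perm.
by rewrite odd_tperm j12 /= expr1 !mulr1 mulrN1 -mulrN opprB.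
Qed.

Lemma vertex_disjoint s g : vertex s g -> [disjoint s.1 & s.2].
Proof.
move=> [_ gB ->]; rewrite -setI_eq0; apply/eqP/setP => i.
by rewrite !inE; apply/negP => /andP[+ iB]; rewrite gB // ltxx.
Qed.

Lemma regular_tilingP s : (0 < d)%N ->
  s \in regular_tiling a h <-> exists g, vertex s g.
Proof.
move=> d_gt0; rewrite inE; split.
  move=> /asboolP[[dj cB _] [f [BE det_gt0 IE]]].
  have [|fI bB] := @unit_lin_basis _ _ _ (fun i => v i) f.
    by rewrite unitmxE unitfE gt_eqF.
  rewrite -BE in bB; have [g gB] := interpolation bB.
  exists g; split=> //; rewrite IE; apply/setP => i; rewrite !inE.
  rewrite (@det_lifted_mx f g) => [|k]; last by rewrite gB // BE imset_f.
  rewrite pmulr_rgt0 // subr_gt0; have [iB|//] := boolP (i \in s.2).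
  by rewrite gB // ltxx.
move=> [g sg]; have [bB gB IE] := sg; apply/asboolP; split.
  split; first exact: vertex_disjoint sg.
    by rewrite -addn1; case: bB.
  move=> [c [[i iB ci] c0 ca]]; have [E [dE _]] := dual_basis_exists bB.
  have cv : \sum_(j in s.2) c j *: v j = 0.
    rewrite (eq_bigr (fun j => row_mx (c j *: a j) (c j)%:M)) => [|j _].
      apply/rowP => k; rewrite summxE mxE.
      case: (split_ordP k) => k' ->.
        under eq_bigr do rewrite row_mxEl.
        by rewrite -summxE ca mxE.
      under eq_bigr do rewrite row_mxEr (ord1 k') mxE eqxx mulr1n.
      exact: c0.
    by rewrite scale_row_mx scale_scalar_mx mulr1.
  have := congr1 (dot (E i)) cv; rewrite dot_sumr (bigD1 i) //= big1.
    rewrite dotZr dE // eqxx mulr1 addr0 => ci0.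
    by move: ci; rewrite ci0 dot0r eqxx.
  by move=> j /andP[jB ji]; rewrite dotZr dE // eq_sym (negPf ji) mulr0.
have [f [fI BE uM]] := lin_basis_enum bB.
(* Swapping two entries of the ordering changes the sign of the determinant; [0 < d] provides two
   distinct positions. *)
wlog det_gt0 : f fI BE uM / 0 < \det (basis_mx a f).
  move=> hw; have [/(hw f fI BE uM)//|] := ltP 0 (\det (basis_mx a f)).
  rewrite le_eqVlt => /orP[/eqP det0|det_lt0].
    by move: uM; rewrite unitmxE unitfE -/(basis_mx a f) det0 eqxx.
  pose i1 : 'I_(d + 1) := lshift 1 (Ordinal d_gt0).
  pose i2 : 'I_(d + 1) := rshift d ord0.
  have det_t : \det (basis_mx a (f \o tperm i1 i2)) = - \det (basis_mx a f).
    have -> : basis_mx a (f \o tperm i1 i2) =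
        row_perm (tperm i1 i2) (basis_mx a f).
      by apply/matrixP => k l; rewrite !mxE.
    by rewrite row_permE det_mulmx det_perm odd_tperm eq_lrshift /= expr1 mulN1r.
  apply: (hw (f \o tperm i1 i2)).
  - exact: inj_comp fI perm_inj.
  - rewrite BE; apply/setP => i; apply/imsetP/imsetP => -[k _ ->].
      by exists (tperm i1 i2 k) => //=; rewrite tpermK.
    by exists (tperm i1 i2 k).
  - by rewrite unitmxE unitfE -/(basis_mx a _) det_t oppr_eq0 lt_eqF.
  - by rewrite det_t oppr_gt0.
exists f; split=> //; rewrite IE; apply/setP => i; rewrite !inE.
rewrite (@det_lifted_mx f g) => [|k]; last by rewrite gB // BE imset_f.
rewrite pmulr_rgt0 // subr_gt0; have [iB|//] := boolP (i \in s.2).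
by rewrite gB // ltxx.
Qed.

(** If some [i] outside [s.2] were tight, the barycentric coordinates of [a i] would also express
    its height, making [i |: s.2] a dependent set of [d + 2] lifted points. Genericity would put it
    on a vertical hyperplane, which affine independence of [s.2] excludes. *)
Lemma generic_tight s g i : generic_height a h -> vertex s g ->
  (dot g (v i) == h i) = (i \in s.2).
Proof.
move=> gen [bB gB _]; apply/idP/idP => [/eqP gi|/gB/eqP//].
apply/negPn/negP => iB; have [E [dE vE]] := dual_basis_exists bB.
have /homog_sum[E1 aE] := vE (v i).
have hE : h i = \sum_(j in s.2) dot (E j) (v i) * h j.
  rewrite -gi [in LHS](vE (v i)) dot_sumr; apply: eq_bigr => j jB.
  by rewrite dotZr gB.
case: (gen (i |: s.2)).
- by rewrite cardsU1 iB /=; rewrite (proj1 bB) addn1.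
- pose c j := if j == i then 1 else - dot (E j) (v i).
  have cB j : j \in s.2 -> c j = - dot (E j) (v i).
    by rewrite /c; have [->|//] := eqVneq j i; rewrite (negPf iB).
  have ci : c i = 1 by rewrite /c eqxx.
  exists c; split; first by exists i; rewrite ?setU11 // ci oner_eq0.
    rewrite big_setU1 //= ci (eq_bigr _ cB) sumrN E1 subrr //.
  rewrite big_setU1 //= ci scale1r.
  have -> : \sum_(j in s.2) c j *: lifted a h j = - lifted a h i.
    rewrite (eq_bigr (fun j => - (dot (E j) (v i) *: lifted a h j))) => [|j jB].
      rewrite sumrN; congr (- _); apply/rowP => k; rewrite summxE.
      case: (split_ordP k) => k' ->.
        rewrite [RHS]row_mxEl [X in _ = fun_of_matrix X _ _]aE summxE.
        by apply: eq_bigr => j _; rewrite mxE row_mxEl [RHS]mxE.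
      rewrite [RHS]row_mxEr (ord1 k') [RHS]mxE eqxx mulr1n hE.
      by apply: eq_bigr => j jB; rewrite mxE row_mxEr mxE eqxx mulr1n.
    by rewrite cB // scaleNr.
  by rewrite subrr.
move=> N [c [N0 Nlast Nc]].
(* A vertical hyperplane is an affine function on the base space; it vanishes on all of [s.2], so it
   is zero. *)
pose N' := row_mx (lsubmx N) (- c)%:M.
have N'0 : N' = 0.
  case: bB => _; apply=> b bB; have := Nc b; rewrite inE bB orbT => /(_ isT).
  rewrite -{1}(hsubmxK N) /lifted /N' /homog !dot_row_mx.
  have -> : rsubmx N = 0.
    by apply/rowP => k; rewrite (ord1 k) !mxE; exact: Nlast.
  rewrite /dot !big_ord1 !mxE !mulr1n mul0r addr0 mulr1 => ->.
  by rewrite subrr.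
case/eqP: N0; rewrite -(hsubmxK N).
have -> : rsubmx N = 0.
  by apply/rowP => k; rewrite (ord1 k) !mxE; exact: Nlast.
have /eq_row_mx[-> _] : N' = row_mx 0 0 by rewrite row_mx0.
by rewrite row_mx0.
Qed.

End Vertices.

(** * Facets as edges of the arrangement *)

Section Edges.
Variables (R : realType) (d n : nat) (a : 'I_n -> 'rV[R]_d) (h : 'I_n -> R).

Local Notation v i := (homog (a i)).
Local Notation vertex := (vertex a h).

Lemma facetP (F s : label n) : is_facet F s ->
  exists b, [/\ b \in s.2, F.2 = s.2 :\ b & F.1 = s.1 \/ F.1 = b |: s.1].
Proof.
by move=> /existsP[b /andP[bs /andP[/eqP F2 /orP[/eqP F1|/eqP F1]]]];
  exists b; split=> //; [left|right].
Qed.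

(** These weak inequalities depend on [F] alone: the vertices of all tiles with facet [F] lie in one
    closed convex cell. *)
Lemma facet_vertex F s g : vertex s g -> is_facet F s ->
  [/\ forall j, j \in F.1 -> h j <= dot g (v j),
      forall j, j \notin F.1 -> dot g (v j) <= h j &
      forall j, j \in F.2 -> dot g (v j) = h j].
Proof.
move=> [_ gB IE] /facetP[b [bs -> F1]].
have low j : j \notin s.1 -> dot g (v j) <= h j by rewrite IE inE -leNgt.
split=> j; last by rewrite in_setD1 => /andP[_ /gB].
  case: F1 => ->; first by rewrite IE inE => /ltW.
  by rewrite in_setU1 IE inE => /orP[/eqP->|/ltW//]; rewrite gB.
case: F1 => ->; first exact: low.
by rewrite in_setU1 negb_or => /andP[_ /low].
Qed.

Lemma vertex_unique s g g' : vertex s g -> vertex s g' -> g = g'.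
Proof.
move=> [bB gB _] [_ gB' _]; apply: (lin_basis_dot_inj bB) => b bs.
by rewrite gB ?gB'.
Qed.

Lemma vertex_inj s t g g' : vertex s g -> vertex t g' -> s.2 = t.2 -> s = t.
Proof.
move=> [bs gs Is] [bt gt It] st.
have gg : g = g'.
  by apply: (lin_basis_dot_inj bs) => b bB; rewrite gs // gt // -st.
by rewrite (surjective_pairing s) (surjective_pairing t) st Is It gg.
Qed.

Hypothesis gen : generic_height a h.

Lemma vertex_below s g i : vertex s g -> i \in s.1 -> h i < dot g (v i).
Proof. by move=> [_ _ ->]; rewrite inE. Qed.

Lemma vertex_above s g i : vertex s g -> i \notin s.1 -> i \notin s.2 ->
  dot g (v i) < h i.
Proof.
move=> sg; rewrite -(generic_tight i gen sg) lt_neqAle => is1 ->.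
by move: is1; have [_ _ ->] := sg; rewrite inE -leNgt.
Qed.

(* If [g2] is strictly between [g1] and [g3] on an edge of the arrangement, the
   hyperplane cutting the edge at [g2] would have to contain [g1]. *)
Lemma facet_not_between F s1 s2 s3 g1 g2 g3 p q :
  vertex s1 g1 -> vertex s2 g2 -> vertex s3 g3 ->
  is_facet F s1 -> is_facet F s2 -> is_facet F s3 ->
  0 < p -> 0 < q -> (p + q) *: g2 = p *: g1 + q *: g3 -> s1 = s2.
Proof.
move=> V1 V2 V3 F1 F2 F3 p0 q0 e.
have [in1 out1 _] := facet_vertex V1 F1.
have [in3 out3 _] := facet_vertex V3 F3.
have [b [bs FE _]] := facetP F2.
have g2b : dot g2 (v b) = h b by have [_ ->] := V2.
have := congr1 (fun w => dot w (v b)) e; rewrite dotZl dotDl !dotZl g2b => eb.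
(* [h b] is a proper average of the values of [g1] and [g3] at [v b], both on the same side of
   [h b], so both equal it. *)
have g1b : dot g1 (v b) = h b.
  have [bF|bF] := boolP (b \in F.1).
    by move: (in1 _ bF) (in3 _ bF); nra.
  by move: (out1 _ bF) (out3 _ bF); nra.
apply: (vertex_inj V1 V2); apply/esym/eqP; rewrite eqEcard.
have [[-> _] _ _] := V1; have [[-> _] _ _] := V2; rewrite leqnn andbT.
apply/subsetP => i; have [-> _|ib is2] := eqVneq i b.
  by rewrite -(generic_tight b gen V1) g1b.
have [c [cs FE1 _]] := facetP F1.
have : i \in F.2 by rewrite FE in_setD1 ib.
by rewrite FE1 in_setD1 => /andP[].
Qed.

Lemma facet_line F s g : vertex s g -> is_facet F s ->
  exists u, forall w, (forall c, c \in F.2 -> dot w (v c) = 0) ->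
    exists t, w = t *: u.
Proof.
move=> [bB _ _] /facetP[b [bs FE _]].
have [E [dE _]] := dual_basis_exists bB.
exists (E b) => w wF; exists (dot w (v b)).
apply: (lin_basis_dot_inj bB) => c cs; rewrite dotZl dE //.
have [<-|bc] := eqVneq b c; first by rewrite mulr1.
by rewrite mulr0 wF // FE in_setD1 eq_sym bc.
Qed.

(** The vertices lie on one line, and distinct tiles have distinct vertices by genericity. Of three
    distinct vertices one would lie strictly between the others. *)
Lemma facet_at_most_two F s1 s2 s3 g1 g2 g3 :
  vertex s1 g1 -> vertex s2 g2 -> vertex s3 g3 ->
  is_facet F s1 -> is_facet F s2 -> is_facet F s3 ->
  s1 != s2 -> (s3 == s1) || (s3 == s2).
Proof.
move=> V1 V2 V3 F1 F2 F3 s12; apply: contraT; rewrite negb_or => /andP[s31 s32].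
have [u uP] := facet_line V1 F1.
have [_ _ t1] := facet_vertex V1 F1; have [_ _ t2] := facet_vertex V2 F2.
have [_ _ t3] := facet_vertex V3 F3.
have [|x2 e2] := uP (g2 - g1).
  by move=> c cF; rewrite dotDl dotNl t1 ?t2 ?subrr.
have [|x3 e3] := uP (g3 - g1).
  by move=> c cF; rewrite dotDl dotNl t1 ?t3 ?subrr.
have {}e2 : g2 = g1 + x2 *: u by rewrite -e2 addrC subrK.
have {}e3 : g3 = g1 + x3 *: u by rewrite -e3 addrC subrK.
have ne s t g g' : vertex s g -> vertex t g' -> s != t -> g <> g'.
  move=> Vs Vt /eqP st gg; apply: st; apply: (vertex_inj Vs Vt).
  by apply/setP => i; rewrite -(generic_tight i gen Vs) -(generic_tight i gen Vt) gg.
have x20 : x2 != 0.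
  by apply/eqP => x0; apply: (ne _ _ _ _ V1 V2 s12); rewrite e2 x0 scale0r addr0.
have x30 : x3 != 0.
  apply/eqP => x0; apply: (ne _ _ _ _ V3 V1 s31).
  by rewrite e3 x0 scale0r addr0.
have x23 : x2 != x3.
  by apply/eqP => x0; apply: (ne _ _ _ _ V3 V2 s32); rewrite e3 e2 x0.
have btw (y1 y2 y3 : R) (s t r : label n) :
    vertex s (g1 + y1 *: u) -> vertex t (g1 + y2 *: u) -> vertex r (g1 + y3 *: u) ->
    is_facet F s -> is_facet F t -> is_facet F r -> y1 < y2 -> y2 < y3 -> s = t.
  move=> Vs Vt Vr Fs Ft Fr y12 y23.
  apply: (@facet_not_between F s t r _ _ _ (y3 - y2) (y2 - y1) Vs Vt Vr) => //;
    rewrite ?subr_gt0 //.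
  rewrite !scalerDr !scalerA [RHS]addrACA -!scalerDl; congr (_ *: _ + _ *: _); ring.
have V1' : vertex s1 (g1 + 0 *: u) by rewrite scale0r addr0.
rewrite e2 in V2; rewrite e3 in V3.
(* The parameters of the three vertices are 0, [x2] and [x3]. Six of the eight sign patterns are
   orderings with a middle vertex; the other two are inconsistent. *)
case/lt_total/orP: x20 => x20; case/lt_total/orP: x30 => x30;
  case/lt_total/orP: x23 => x23.
- by move/eqP: s32; rewrite (btw _ _ _ _ _ _ V2 V3 V1').
- by move/eqP: s32; rewrite (btw _ _ _ _ _ _ V3 V2 V1').
- by move/eqP: s12; rewrite -(btw _ _ _ _ _ _ V2 V1' V3).
- by have := lt_trans (lt_trans x20 x30) x23; rewrite ltxx.
- by have := lt_trans (lt_trans x30 x20) x23; rewrite ltxx.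
- by move/eqP: s31; rewrite -(btw _ _ _ _ _ _ V3 V1' V2).
- by move/eqP: s12; rewrite (btw _ _ _ _ _ _ V1' V2 V3).
- by move/eqP: s31; rewrite (btw _ _ _ _ _ _ V1' V3 V2).
Qed.

(** Genericity of [x] only concerns facets with exactly two tiles; this makes it available for any
    facet shared by two tiles. *)
Lemma internal_facetP F s t g g' : (0 < d)%N -> vertex s g -> vertex t g' ->
  is_facet F s -> is_facet F t -> s != t -> internal_facet a h F.
Proof.
move=> d_gt0 Vs Vt Fs Ft st; rewrite /internal_facet.
suff -> : [set r in regular_tiling a h | is_facet F r] = [set s; t].
  by rewrite cards2 st.
apply/setP => r; rewrite !inE; apply/andP/orP => [[rP Fr]|[]/eqP->].
- have [g3 Vr] : exists g, vertex r g by apply/regular_tilingP; rewrite // inE.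
  by apply/orP; apply: (facet_at_most_two Vs Vt Vr Fs Ft Fr).
- split=> //; have : s \in regular_tiling a h by apply/regular_tilingP => //; exists g.
  by rewrite inE.
- split=> //; have : t \in regular_tiling a h by apply/regular_tilingP => //; exists g'.
  by rewrite inE.
Qed.

End Edges.

(** * Moving along an edge to the next vertex *)

Section Crossing.
Variables (R : realType) (d n : nat) (a : 'I_n -> 'rV[R]_d) (h : 'I_n -> R).

Local Notation v i := (homog (a i)).
Local Notation vertex := (vertex a h).

Hypothesis gen : generic_height a h.

(* Leaving the vertex [g] in direction [u], along the edge on which all the
   hyperplanes of [s.2] other than [b] stay tight. *)
Lemma cross_facet s g b u i0 : vertex s g -> b \in s.2 ->
  (forall c, c \in s.2 :\ b -> dot u (v c) = 0) -> dot u (v b) != 0 ->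
  i0 \notin s.2 ->
  0 < (if i0 \in s.1 then - dot u (v i0) else dot u (v i0)) ->
  let J := if dot u (v b) < 0 then s.1 else b |: s.1 in
  exists t, exists r, exists b', [/\ vertex t (g + r *: u), 0 < r,
    b' \notin s.2 /\
      0 < (if b' \in s.1 then - dot u (v b') else dot u (v b')),
    t = (J :\ b', b' |: s.2 :\ b) &
    is_facet (J, s.2 :\ b) s /\ is_facet (J, s.2 :\ b) t].
Proof.
move=> Vs bs uC ub i0s rate0 J.
(* [sl i] is the slack of hyperplane [i] at [g] and [rt i] the rate at which it shrinks along [u];
   the ratio test finds the first hyperplane [b'] that is hit. *)
pose sl i := if i \in s.1 then dot g (v i) - h i else h i - dot g (v i).
pose rt i := if i \in s.1 then - dot u (v i) else dot u (v i).
have sl_gt0 i : i \notin s.2 -> 0 < sl i.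
  rewrite /sl => is2; case: ifPn => is1; rewrite subr_gt0.
    exact: vertex_below Vs is1.
  by apply: (vertex_above gen Vs).
have [||b' [r [b's2 rb' r0 slE sl_ge]]] :=
    @ratio_test R _ (fun i => i \notin s.2) sl rt.
- by move=> j /sl_gt0/ltW.
- by exists i0.
have {}r0 : 0 < r.
  by rewrite -(pmulr_lgt0 _ rb') -slE sl_gt0.
have ub' : dot u (v b') != 0.
  by move: rb'; rewrite /rt; case: ifP => _; rewrite ?oppr_gt0;
    [move/lt_eqF->|move/gt_eqF->].
have [bB gB IE] := Vs.
have gu i : dot (g + r *: u) (v i) = dot g (v i) + r * dot u (v i).
  by rewrite dotDl dotZl.
have b'b : b' != b by apply: contraNneq b's2 => ->.
pose t : label n := ([set i | h i < dot (g + r *: u) (v i)], b' |: s.2 :\ b).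
have Vt : vertex t (g + r *: u).
  split=> //=; first exact: lin_basis_exchange bs uC ub'.
  move=> c; rewrite in_setU1 => /orP[/eqP->|cC]; rewrite gu; last first.
    by rewrite uC // mulr0 addr0 gB //; move: cC; rewrite in_setD1 => /andP[].
  by move: slE; rewrite /sl /rt; case: ifP => _; lra.
(* Up to the new vertex only [b] can change sides, according to the sign of [dot u (v b)];
   genericity excludes a tie with [b']. *)
have t1 : t.1 = J :\ b'.
  apply/setP => i; rewrite inE in_setD1.
  have [->|ib'] /= := eqVneq i b'.
    have [_ tB _] := Vt; by rewrite tB /= ?setU11 // ltxx.
  have [->|ib] := eqVneq i b.
    rewrite gu gB // ltrDl pmulr_rgt0 // /J.
    have bs1 : b \notin s.1 by rewrite IE inE gB // ltxx.
    case: (ltP (dot u (v b)) 0) => [u0|].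
      by rewrite (negPf bs1); apply/negbTE; rewrite -leNgt ltW.
    by rewrite le_eqVlt eq_sym (negPf ub) setU11 => /= ->.
  have -> : (i \in J) = (i \in s.1).
    by rewrite /J; case: ifP => // _; rewrite in_setU1 (negPf ib).
  have [is2|is2] := boolP (i \in s.2).
    have iC : i \in s.2 :\ b by rewrite in_setD1 ib.
    by rewrite gu uC // mulr0 addr0 IE inE.
  have it2 : i \notin t.2 by rewrite /= in_setU1 in_setD1 negb_or ib' negb_and is2 orbT.
  have := sl_ge i is2; rewrite -(generic_tight i gen Vt) gu in it2 *.
  rewrite /sl /rt; case: ifP => is1 le0; first by rewrite lt_neqAle eq_sym it2 /=; lra.
  by apply/negbTE; rewrite -leNgt; lra.
exists t, r, b'; split=> //; first by rewrite -t1.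
split; apply/existsP.
  exists b; rewrite bs eqxx /= /J; case: ifP => _; by rewrite eqxx ?orbT.
exists b'; rewrite setU11 t1 /= setU1K ?eqxx /=; last first.
  by rewrite in_setD1 negb_and b's2 orbT.
have [b'J|b'J] := boolP (b' \in J); first by rewrite setD1K // eqxx orbT.
by rewrite (setDidPl _) ?eqxx // disjoint_sym disjoints1.
Qed.

End Crossing.

(** * The orientation of the edges determined by the point *)

Section Arrows.
Variables (R : realType) (d n : nat) (a : 'I_n -> 'rV[R]_d) (h : 'I_n -> R).
Variable x : 'rV[R]_d.

Local Notation v i := (homog (a i)).
Local Notation dual := (dual_basis (fun i => v i)).
Local Notation vertex := (vertex a h).

Hypothesis gen : generic_height a h.

(** An interior point can be shifted both ways along [v b] within the tile. By uniqueness of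
    coordinates this changes only [c b], which must remain in [0, 1]. *)
Lemma tile_interior s g z : vertex s g -> interior (zonotope_tile a s) z ->
  exists2 c : 'I_n -> R, forall b, b \in s.2 -> 0 < c b < 1 &
    z = \sum_(i in s.1) v i + \sum_(b in s.2) c b *: v b.
Proof.
move=> [bB _ _] zint; have [E dualE] := dual_basis_exists bB.
have [dE _] := dualE.
have [c c01 zE] := interior_subset zint.
exists c => // b bs.
have cvgz : ((fun t : R => z + t *: v b) @ (0 : R) --> z + 0 *: v b)%classic.
  by apply: cvgD; [exact: cvg_cst|apply: cvgZr_tmp; exact: cvg_id].
rewrite scale0r addr0 in cvgz.
have /nbhs_ballP[e /= e0 he] := cvgz _ zint.
have tile t : `|t| < e -> 0 <= c b + t <= 1.
  move=> te; have [|c' c'01] := he t.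
    by rewrite /ball /= sub0r normrN.
  rewrite zE -addrA => /addrI/(congr1 (dot (E b))).
  rewrite dotDr !(dual_basis_coord _ dualE) // dotZr dE // eqxx mulr1 => ->.
  exact: c'01.
have := tile (e / 2); have := tile (- (e / 2)).
rewrite normrN gtr0_norm ?divr_gt0 // ltr_pdivrMr // ltr_pMr // ltr1n.
by move=> /(_ isT)/andP[? ?] /(_ isT)/andP[? ?]; apply/andP; split; lra.
Qed.

(** Otherwise one of the directions [E b] and [- E b] runs into another hyperplane, so the facet
    opposite [b] is internal; its affine hull contains [x], against genericity. *)
Lemma zero_coordinate s g E b i : (0 < d)%N -> generic_point a h x ->
  vertex s g -> dual s.2 E -> b \in s.2 -> dot (E b) (homog x) = 0 -> i != b ->
  dot (E b) (v i) = 0.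
Proof.
move=> d_gt0 genx Vs [dE vE] bs xb ib; apply/eqP/negPn/negP => Ei.
have is2 : i \notin s.2.
  by apply: contra Ei => is2; rewrite dE // (eq_sym b) (negPf ib).
have EC c : c \in s.2 :\ b -> dot (E b) (v c) = 0.
  by rewrite in_setD1 => /andP[cb cs]; rewrite dE // eq_sym (negPf cb).
have [u [uC ub ui]] : exists u, [/\ forall c, c \in s.2 :\ b -> dot u (v c) = 0,
    dot u (v b) != 0 & 0 < if i \in s.1 then - dot u (v i) else dot u (v i)].
  have Eb : dot (E b) (v b) != 0 by rewrite dE // eqxx oner_eq0.
  have [Ep|En] : 0 < (if i \in s.1 then - dot (E b) (v i) else dot (E b) (v i)) \/
      0 < (if i \in s.1 then dot (E b) (v i) else - dot (E b) (v i)).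
  - by case/lt_total/orP: Ei; case: ifP => _; rewrite oppr_gt0; auto.
  - by exists (E b).
  - exists (- E b); split=> [c cC||]; rewrite ?dotNl ?oppr_eq0 //.
      by rewrite EC // oppr0.
    by rewrite opprK.
have [t [r [b' [Vt _ [b's2 _] tE [Fs Ft]]]]] := cross_facet gen Vs bs uC ub is2 ui.
have st : s != t.
  apply: contraNneq b's2 => ->; rewrite tE; exact: setU11.
apply: (genx _ (internal_facetP gen d_gt0 Vs Vt Fs Ft st)) => /=.
exists (fun c => dot (E c) (homog x)); apply/homog_sum.
by rewrite {1}(vE (homog x)) (big_setD1 b) //= xb scale0r add0r.
Qed.

(** Any normal of the common facet is a multiple of [E b], so both pairings in the orientation rule
    equal [dot N (v b)] times a positive number. *)
Lemma cross_arrow s g E b t r b' : (0 < d)%N -> vertex t g -> dual t.2 E ->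
  b \in t.2 -> 0 < dot (E b) (homog x) -> vertex s (g - r *: E b) ->
  b' \notin t.2 ->
  0 < (if b' \in t.1 then dot (E b) (v b') else - dot (E b) (v b')) ->
  s = (t.1 :\ b', b' |: t.2 :\ b) ->
  is_facet (t.1, t.2 :\ b) s -> is_facet (t.1, t.2 :\ b) t -> arrow a h x s t.
Proof.
move=> d_gt0 Vt [dE vE] bt xb Vs b't rate sE Fs Ft.
have bs : b \notin s.2.
  by rewrite sE /= in_setU1 in_setD1 eqxx orbF; apply: contraNneq b't => <-.
split.
  split; [| |by apply: contraNneq bs => ->|by exists (t.1, t.2 :\ b); rewrite Fs].
  - by apply/regular_tilingP => //; exists (g - r *: E b).
  - by apply/regular_tilingP => //; exists g.
move=> F N /facetP[b1 [b1s FE1 _]] /facetP[b2 [b2t FE2 _]] [N0 NF] z z' zs zt.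
(* Since [b] is not in [s.2], every facet common to both tiles omits [b]. *)
have b2b : b2 = b.
  apply/eqP; apply: contraNT bs => b2b.
  have : b \in F.2 by rewrite FE2 in_setD1 eq_sym b2b.
  by rewrite FE1 in_setD1 => /andP[].
have [bB _ _] := Vt.
have NE : N = dot N (v b) *: E b.
  apply: (lin_basis_dot_inj bB) => c ct; rewrite dotZl dE //.
  have [<-|bc] := eqVneq b c; first by rewrite mulr1.
  by rewrite mulr0 NF // FE2 b2b in_setD1 eq_sym bc.
have Nb : dot N (v b) != 0.
  by apply: contraNneq N0 => Nb; rewrite NE Nb scale0r.
have NC c : c \in t.2 :\ b -> dot N (v c) = 0.
  by move=> cC; rewrite NF // FE2 b2b.
have [c c01 ->] := tile_interior Vs zs.
have [c' c'01 ->] := tile_interior Vt zt.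
have b'C : b' \notin t.2 :\ b by rewrite in_setD1 negb_and b't orbT.
have Nz : dot N (\sum_(i in s.1) v i + \sum_(j in s.2) c j *: v j) =
    dot N (\sum_(i in s.1) v i) + c b' * dot N (v b').
  rewrite dotDr; congr (_ + _); rewrite dot_sumr sE /= big_setU1 //= dotZr.
  by rewrite big1 ?addr0 // => j jC; rewrite dotZr NC ?mulr0.
have Nz' : dot N (\sum_(i in t.1) v i + \sum_(j in t.2) c' j *: v j) =
    dot N (\sum_(i in t.1) v i) + c' b * dot N (v b).
  rewrite dotDr; congr (_ + _); rewrite dot_sumr (big_setD1 b) //= dotZr.
  by rewrite big1 ?addr0 // => j jC; rewrite dotZr NC ?mulr0.
have Nt1 : dot N (\sum_(i in t.1) v i) = dot N (\sum_(i in s.1) v i) +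
    (b' \in t.1)%:R * dot N (v b').
  rewrite sE /=; have [b't1|b't1] := boolP (b' \in t.1).
    by rewrite (big_setD1 b') //= dotDr mul1r addrC.
  rewrite mul0r addr0 (setDidPl _) //.
  by rewrite disjoint_sym disjoints1.
rewrite dotDr dotNr Nz Nz' Nt1.
have /andP[c0 c1] : 0 < c b' < 1 by apply: c01; rewrite sE setU11.
have /andP[c'0 c'1] := c'01 _ bt.
(* [k] records whether [v b'] is a fixed summand of the tile [t]; in [s] it always spans a
   segment. *)
set k := (b' \in t.1)%:R.
have -> : dot N (\sum_(i in s.1) v i) + k * dot N (v b') + c' b * dot N (v b) -
    (dot N (\sum_(i in s.1) v i) + c b' * dot N (v b')) =
    dot N (v b) * (c' b + (k - c b') * dot (E b) (v b')).
  rewrite [in dot N (v b')]NE dotZl; ring.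
rewrite [in LHS]NE dotZl !sgrM; congr (_ * _).
rewrite !gtr0_sg // ltr_pwDl // /k; move: rate; case: ifP => _ rate /=.
  by apply: mulr_ge0; [rewrite subr_ge0 ltW|exact: ltW].
by rewrite sub0r mulNr -mulrN mulr_ge0 // ltW.
Qed.

End Arrows.

(** * The descending walk to a tile with empty [I] *)

Section Descent.
Variables (R : realType) (d n : nat) (a : 'I_n -> 'rV[R]_d) (h : 'I_n -> R).
Variable x : 'rV[R]_d.

Local Notation v i := (homog (a i)).
Local Notation basis := (lin_basis (fun i => v i)).
Local Notation dual := (dual_basis (fun i => v i)).
Local Notation vertex := (vertex a h).

Hypothesis gen : generic_height a h.

(* Any nonnegative combination representing [x] over [t.1 :|: t.2] can be pushed
   in the direction of [t.1] until the coefficient of some [b] in [t.2] vanishes;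
   this [b] has a positive coordinate at [x]. *)
Lemma removable_element t g E : (0 < d)%N -> generic_point a h x ->
  vertex t g -> dual t.2 E -> supported a x t -> t.1 != finset.set0 ->
  exists b, [/\ b \in t.2, 0 < dot (E b) (homog x),
    exists2 i, i \in t.1 & 0 < dot (E b) (v i) &
    conv_hull a ((t.1 :|: t.2) :\ b) x].
Proof.
move=> d_gt0 genx Vt dualE /conv_hullP[c0 [c0_ge0 xE0]] t1n0.
have [dE vE] := dualE; have dis := vertex_disjoint Vt.
have E1 i : \sum_(b in t.2) dot (E b) (v i) = 1.
  by have /homog_sum[] := vE (v i).
have splitU (F : 'I_n -> 'rV[R]_(d + 1)) : \sum_(i in t.1 :|: t.2) F i =
    \sum_(i in t.1) F i + \sum_(i in t.2) F i.
  by rewrite -bigU //=; apply: eq_bigl => i; rewrite !inE.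
(* If the given weights on [t.1] all vanish, they are replaced by unit weights with total
   contribution [mu = 0], so that a pushing direction exists in either case. *)
have [c [mu [y [c_ge0 c_gt0 mu0 y0 xE]]]] : exists (c : 'I_n -> R) mu y,
    [/\ forall i, i \in t.1 -> 0 <= c i, 0 < \sum_(i in t.1) c i, 0 <= mu,
        forall b, b \in t.2 -> 0 <= y b &
        homog x = mu *: (\sum_(i in t.1) c i *: v i) + \sum_(b in t.2) y b *: v b].
  have c0t1 i : i \in t.1 -> 0 <= c0 i by move=> it; apply: c0_ge0; rewrite inE it.
  have c0t2 i : i \in t.2 -> 0 <= c0 i.
    by move=> it; apply: c0_ge0; rewrite inE it orbT.
  rewrite splitU in xE0.
  have : 0 <= \sum_(i in t.1) c0 i by rewrite sumr_ge0.
  rewrite le_eqVlt => /orP[/eqP/esym|] c0s.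
    exists (fun=> 1), 0, c0; split=> //.
      rewrite sumr_const ltr0n card_gt0 //.
    rewrite xE0 scale0r; congr (_ + _); apply: big1 => i it.
    by rewrite (psumr_eq0P c0t1 c0s) // scale0r.
  by exists c0, 1, c0; split=> //; rewrite scale1r.
(* [w] is the pushing direction in the basis [t.2]. Its coordinates have positive sum, so some
   weight in [y] decreases and the ratio test applies. *)
pose w b := \sum_(i in t.1) c i * dot (E b) (v i).
have wE : \sum_(i in t.1) c i *: v i = \sum_(b in t.2) w b *: v b.
  rewrite [LHS](vE _); apply: eq_bigr => b bt; congr (_ *: _).
  by rewrite dot_sumr; apply: eq_bigr => i _; rewrite dotZr.
have w_sum : \sum_(b in t.2) w b = \sum_(i in t.1) c i.
  rewrite exchange_big /=; apply: eq_bigr => i _.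
  by rewrite -mulr_sumr E1 mulr1.
have [b1 b1t wb1] : exists2 b, b \in t.2 & 0 < w b.
  apply: contrapT => H; move: c_gt0; rewrite -w_sum ltNge sumr_le0 // => b bt.
  by rewrite leNgt; apply/negP => wb; apply: H; exists b.
have [|b [tau [bt wb tau0 yb yt]]] :=
  @ratio_test R _ (fun b => b \in t.2) y w y0; first by exists b1.
have [i it Ei] : exists2 i, i \in t.1 & 0 < dot (E b) (v i).
  apply: contrapT => H; move: wb; rewrite ltNge sumr_le0 // => i it.
  by rewrite mulr_ge0_le0 ?c_ge0 // leNgt; apply/negP => Ei; apply: H; exists i.
have xb : dot (E b) (homog x) = (mu + tau) * w b.
  by rewrite xE wE dotDr dotZr !(dual_basis_coord _ dualE) // yb mulrDl.
(* If the coordinate of [x] at [b] were zero, so would be that of [a i], contradicting the choice of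
   [i]. *)
have xb_gt0 : 0 < dot (E b) (homog x).
  rewrite xb lt_neqAle mulr_ge0 ?addr_ge0 // ?(ltW wb) // andbT eq_sym -xb.
  apply: contraTneq Ei => xb0.
  rewrite (zero_coordinate gen d_gt0 genx Vt dualE bt xb0) ?ltxx //.
  by apply: contraTneq it => ->; rewrite (disjointFl dis).
exists b; split=> //; first by exists i.
apply/conv_hullP.
exists (fun i => if i \in t.1 then (mu + tau) * c i else y i - tau * w i).
have bt1 : b \notin t.1 by rewrite (disjointFl dis).
split=> [j|].
  rewrite in_setD1 inE => /andP[jb /orP[jt|jt]].
    by rewrite jt mulr_ge0 ?addr_ge0 ?c_ge0.
  by rewrite (disjointFl dis jt) yt.
apply: etrans (_ : \sum_(i in t.1 :|: t.2)
  (if i \in t.1 then (mu + tau) * c i else y i - tau * w i) *: v i = _); last first.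
  rewrite (big_setD1 b) /=; last by rewrite inE bt orbT.
  by rewrite (negPf bt1) yb subrr scale0r add0r.
rewrite splitU xE.
rewrite [in RHS](eq_bigr (fun i => (mu + tau) *: (c i *: v i))); last first.
  by move=> j ->; rewrite scalerA.
rewrite -scaler_sumr scalerDl -addrA; congr (_ + _).
rewrite wE scaler_sumr -big_split /=; apply: eq_bigr => j jt.
by rewrite (disjointFl dis jt) scalerBl scalerA addrC subrK.
Qed.

Lemma descent t g : (0 < d)%N -> generic_point a h x ->
  vertex t g -> supported a x t -> t.1 != finset.set0 ->
  exists s g', [/\ vertex s g', supported a x s, arrow a h x s t,
    (#|s.1| <= #|t.1|)%N & dot g' (homog x) < dot g (homog x)].
Proof.
move=> d_gt0 genx Vt supp t1n0; have [bB _ _] := Vt.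
have [E dualE] := dual_basis_exists bB; have [dE vE] := dualE.
have [b [bt xb [i it Ei] hull]] := removable_element d_gt0 genx Vt dualE supp t1n0.
(* Along [- E b] the value at [v b] falls below [h b], so [b] leaves the basis without entering
   [I]. *)
have ub : dot (- E b) (v b) = -1 by rewrite dotNl dE // eqxx.
have [||||s [r [b' []]]] := @cross_facet _ _ _ _ _ gen t g b (- E b) i Vt bt.
- move=> c; rewrite in_setD1 => /andP[cb ct].
  by rewrite dotNl dE // eq_sym (negPf cb) oppr0.
- by rewrite ub oppr_eq0 oner_eq0.
- by rewrite (disjointFr (vertex_disjoint Vt) it).
- by rewrite it dotNl opprK.
rewrite ub ltrN10 scalerN !dotNl opprK => Vs r0 [b't rate] sE [Fs Ft].
exists s, (g - r *: E b); split=> //.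
- apply: conv_hullS hull; apply/subsetP => j; rewrite sE !inE /=.
  by case: (j == b') => //=; case: (j == b) => //=.
- exact: (cross_arrow d_gt0 Vt dualE bt xb Vs b't rate sE Ft Fs).
- by rewrite sE /= subset_leq_card // subsetDl.
- by rewrite dotDl dotNl dotZl ltrBlDr ltrDl mulr_gt0.
Qed.

Lemma reach t : (0 < d)%N -> generic_point a h x ->
  t \in regular_tiling a h -> supported a x t ->
  exists z, [/\ z \in regular_tiling0 a h, supported a x z &
    exists p, path (fun u w => `[< arrow a h x u w >]) z p /\ last z p = t /\
      forall s, s \in z :: p -> (#|s.1| <= #|t.1|)%N].
Proof.
move=> d_gt0 genx /(regular_tilingP _ _ _ d_gt0)[g Vt].
(* The walk terminates because the finite set of tiles with a smaller value at [homog x] shrinks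
   strictly: the new tile drops out of it. *)
pose lower y := [set s : {set 'I_n} * {set 'I_n} |
  `[< exists g', vertex s g' /\ dot g' (homog x) < y >]].
have [k] := ubnP #|lower (dot g (homog x))|.
elim: k => // k IH in t g Vt * => ltk supp.
have [t10|t1n0] := eqVneq t.1 finset.set0.
  exists t; split=> //.
    rewrite /regular_tiling0 inE t10 eqxx andbT.
    by apply/regular_tilingP => //; exists g.
  by exists [::]; split=> //; split=> // s; rewrite inE => /eqP ->.
have [s [g' [Vs supps st cst lt_g]]] := descent d_gt0 genx Vt supp t1n0.
have [|//|z [z0 suppz [p [zp [zl zc]]]]] := IH s g' Vs.
  rewrite -ltnS (leq_trans _ ltk) // ltnS proper_card //.
  apply/properP; split.
    apply/subsetP => r; rewrite !inE => /asboolP[g3 [V3 lt3]].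
    by apply/asboolP; exists g3; split=> //; apply: lt_trans lt_g.
  exists s; rewrite !inE; first by apply/asboolP; exists g'.
  apply/asboolP => -[g3 [V3]]; by rewrite (vertex_unique V3 Vs) ltxx.
exists z; split=> //; exists (rcons p t); rewrite rcons_path zp zl last_rcons /=.
split; first exact/asboolP.
split=> // r; rewrite -rcons_cons mem_rcons inE => /orP[/eqP->//|/zc].
by move/leq_trans; apply.
Qed.

(** * Uniqueness of the supported bottom tile by linear programming *)

Lemma supported_bottom_le s g t g' : vertex s g -> vertex t g' ->
  t.1 = finset.set0 -> s.1 = finset.set0 -> supported a x s ->
  dot g' (homog x) <= dot g (homog x).
Proof.
(* Weak duality: [homog x] is a nonnegative combination of vectors at which [g] attains the bound
   [h] and [g'] does not exceed it. *)
move=> [_ gB _] [_ _ It] t0 s0 /conv_hullP[c [c_ge0 ->]].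
rewrite !dot_sumr; apply: ler_sum => i is2; rewrite !dotZr ler_wpM2l ?c_ge0 //.
rewrite gB; last by move: is2; rewrite s0 finset.set0U.
by rewrite leNgt; have := finset.in_set0 i; rewrite -t0 It inE => ->.
Qed.

(** Both vertices are optimal, so complementary slackness makes each [z] in [s.2] either tight at
    [g'], hence in [t.2], or of weight zero. In the latter case, if [z] were not in [t.2], the form
    [E z] would vanish on the basis [t.2]. *)
Lemma supported_bottom_unique s t : (0 < d)%N -> generic_point a h x ->
  s \in regular_tiling0 a h -> t \in regular_tiling0 a h ->
  supported a x s -> supported a x t -> s = t.
Proof.
move=> d_gt0 genx; rewrite [s \in _]inE [t \in _]inE.
move=> /andP[/(regular_tilingP _ _ _ d_gt0)[g Vs] /eqP s0].
move=> /andP[/(regular_tilingP _ _ _ d_gt0)[g' Vt] /eqP t0] supps suppt.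
have eqg : dot g (homog x) = dot g' (homog x).
  apply/eqP; rewrite eq_le (supported_bottom_le Vt Vs) //.
  by rewrite (supported_bottom_le Vs Vt).
apply: (vertex_inj Vs Vt); apply/eqP.
have [[cs _] gB _] := Vs; have [[ct tB] _ It] := Vt.
rewrite eqEcard cs ct leqnn andbT; apply/subsetP => z zs.
have [bB _ _] := Vs; have [E dualE] := dual_basis_exists bB; have [dE vE] := dualE.
move/conv_hullP: supps => [c [c_ge0 xE]]; rewrite s0 finset.set0U in c_ge0 xE.
have slack i : i \in s.2 -> 0 <= c i * (h i - dot g' (v i)).
  move=> is2; rewrite mulr_ge0 ?c_ge0 // subr_ge0 leNgt.
  by have := finset.in_set0 i; rewrite -t0 It inE => ->.
have slack0 : \sum_(i in s.2) c i * (h i - dot g' (v i)) = 0.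
  move/eqP: eqg; rewrite -subr_eq0 xE !dot_sumr -sumrB => /eqP; apply: etrans.
  by apply: eq_bigr => i is2; rewrite !dotZr gB // mulrBr.
have /eqP := psumr_eq0P slack slack0 zs.
rewrite mulf_eq0 subr_eq0 (eq_sym (h z)) (generic_tight z gen Vt).
case/orP=> [/eqP cz|//]; apply: contraT => zt.
have xz : dot (E z) (homog x) = 0.
  rewrite xE dot_sumr big1 // => i is2; rewrite dotZr dE //.
  by have [<-|_] := eqVneq z i; [rewrite cz mul0r|rewrite mulr0].
have Ez : E z = 0.
  apply: tB => i it; apply: (zero_coordinate gen d_gt0 genx Vs dualE zs xz).
  by apply: contraNneq zt => <-.
have := dE z z zs zs; rewrite Ez eqxx dot0l.
by move/eqP; rewrite eq_sym oner_eq0.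
Qed.

(** * Existence of a tile whose labels exhaust all indices *)

Lemma above_spanning_tight (g0 : 'rV[R]_(d + 1)) : aff_spanning a ->
  (forall i, h i <= dot g0 (v i)) ->
  exists g, (forall i, h i <= dot g (v i)) /\
    forall u, (forall i, dot g (v i) = h i -> dot u (v i) = 0) -> u = 0.
Proof.
move=> span; have [k] := ubnP #|[set i | h i < dot g0 (v i)]|.
(* While the tight vectors do not span, some direction keeps them tight and lowers another value;
   following it to the next tight constraint reduces the number of strict ones. *)
elim: k => // k IH in g0 * => ltk g0_ge.
have [tight|] := pselect (forall u,
  (forall i, dot g0 (v i) = h i -> dot u (v i) = 0) -> u = 0).
  by exists g0.
move=> /existsNP[u0 /not_implyP[u0t u00]].
have [u [ut [i ui]]] : exists u : 'rV[R]_(d + 1),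
    (forall i, dot g0 (v i) = h i -> dot u (v i) = 0) /\
    exists i, dot u (v i) < 0.
  have [i ui] : exists i, dot u0 (v i) != 0.
    apply: contrapT => H; apply: u00; apply: (spanning_dot span) => i.
    by apply: contrapT => /eqP ui; apply: H; exists i.
  case/lt_total/orP: ui => ui; first by exists u0; split=> //; exists i.
  exists (- u0); split=> [j /u0t uj|]; first by rewrite dotNl uj oppr0.
  by exists i; rewrite dotNl oppr_lt0.
have [||b [r [_ rb r0 sb sge]]] := @ratio_test R _ predT
    (fun j => dot g0 (v j) - h j) (fun j => - dot u (v j)).
- by move=> j _; rewrite subr_ge0.
- by exists i; rewrite // oppr_gt0.
have gu j : dot (g0 + r *: u) (v j) = dot g0 (v j) + r * dot u (v j).
  by rewrite dotDl dotZl.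
have gb : dot (g0 + r *: u) (v b) = h b by rewrite gu; lra.
apply: (IH (g0 + r *: u)) => [|j]; last by rewrite gu; have := sge j isT; lra.
rewrite -ltnS (leq_trans _ ltk) // ltnS proper_card //; apply/properP; split.
  apply/subsetP => j; rewrite !inE gu => hj.
  rewrite lt_neqAle g0_ge andbT; apply: contraTneq hj => gj.
  by rewrite ut // mulr0 addr0 gj ltxx.
exists b; rewrite !inE; last by rewrite gb ltxx.
rewrite lt_neqAle g0_ge andbT; apply: contraTneq rb => gb'.
by rewrite ut // oppr0 ltxx.
Qed.

Lemma spanning_contains_basis (T : {set 'I_n}) :
  (forall u, (forall i, i \in T -> dot u (v i) = 0) -> u = 0) ->
  exists2 B : {set 'I_n}, B \subset T & basis B.
Proof.
(* Vectors outside [T] are replaced by zero, so a basis chosen among all [n] rows only uses indices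
   in [T]. *)
move=> spanT; pose w i := if i \in T then v i else 0.
pose A : 'M[R]_(n, d + 1) := \matrix_i w i.
have fullA : row_full A.
  rewrite -cokermx_eq0; apply/eqP/matrixP => i j.
  suff /rowP/(_ i) : (col j (cokermx A))^T = 0 by rewrite !mxE.
  apply: spanT => b bT; have /matrixP/(_ b j) := mulmx_coker A.
  rewrite [RHS]mxE => <-; rewrite dotC mxE; apply: eq_bigr => l _.
  by rewrite [A b l]mxE /w bT !mxE.
have uA : (\matrix_k w (fullrankfun fullA k)) \in unitmx.
  have -> : \matrix_k w (fullrankfun fullA k) = rowsub (fullrankfun fullA) A.
    by apply/matrixP => i j; rewrite !mxE.
  exact: fullrowsub_unit.
have [_ bw] := unit_lin_basis uA; set B := [set _ | _ in _] in bw.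
have BT : B \subset T.
  apply/subsetP => b bB; apply: contraT => bT.
  have [E [dE _]] := dual_basis_exists bw.
  have := dE b b bB bB; rewrite eqxx /w (negPf bT).
  by rewrite dot0r => /eqP; rewrite eq_sym oner_eq0.
exists B => //; case: bw => cB sB; split=> // u ub; apply: sB => b bB.
by rewrite /w (subsetP BT _ bB) ub.
Qed.

(** Such a tile is supported on every point of the convex hull, which gives the walk a starting
    point and so proves that a supported bottom tile exists. *)
Lemma top_tile : (0 < d)%N -> aff_spanning a ->
  exists2 t, t \in regular_tiling a h & t.1 :|: t.2 = [set: 'I_n].
Proof.
move=> d_gt0 span.
(* A constant affine function large enough to dominate every height. *)
pose g0 : 'rV[R]_(d + 1) := row_mx 0 (\sum_i `|h i|)%:M.
have g0_ge i : h i <= dot g0 (v i).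
  rewrite dot_row_mx dot0l add0r /dot big_ord1 !mxE eqxx mulr1 mulr1n (bigD1 i) //=.
  by rewrite (le_trans (ler_norm _)) // lerDl sumr_ge0.
have [g [g_ge tight]] := above_spanning_tight span g0_ge.
have [|B BT bB] := @spanning_contains_basis [set i | dot g (v i) == h i].
  by move=> u uT; apply: tight => i gi; apply: uT; rewrite inE gi.
have Vt : vertex ([set i | h i < dot g (v i)], B) g.
  by split=> // b bB'; apply/eqP; have := subsetP BT _ bB'; rewrite inE.
exists ([set i | h i < dot g (v i)], B).
  by apply/regular_tilingP => //; exists g.
apply/setP => i; rewrite !inE /= -(generic_tight i gen Vt) lt_neqAle g_ge andbT.
by rewrite eq_sym orNb.
Qed.

End Descent.

End Tilings.

Theorem proposition3p7 (R : realType) (d n : nat) (a : 'I_n -> 'rV[R]_d)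
    (h : 'I_n -> R) (x : 'rV[R]_d) :
  (0 < d)%N ->
  aff_spanning a ->
  generic_height a h ->
  conv_hull a [set: 'I_n] x ->
  generic_point a h x ->
  exists Z : {set 'I_n},
    unique (fun s : label n => s \in regular_tiling0 a h /\ supported a x s)
      (set0, Z) /\
    forall t : label n, t \in regular_tiling a h -> supported a x t ->
      exists p : seq (label n),
        directed_path a h x (set0, Z) p t /\
        forall s, s \in (set0, Z) :: p -> (#|s.1| <= #|t.1|)%N.
Proof.
move=> d_gt0 span gen hull genx.
have [t0 t0P t0T] := top_tile gen d_gt0 span.
have [|[I Z] [z0 suppz _]] := reach gen d_gt0 genx t0P (x := x).
  by rewrite /supported t0T.
have I0 : I = set0 by move: z0; rewrite inE => /andP[_ /eqP].
rewrite {I}I0 in z0 suppz.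
exists Z; split=> [|t tP suppt].
  split=> // s [s0 supps].
  exact: (supported_bottom_unique gen d_gt0 genx z0 s0 suppz supps).
have [z [z0' suppz' [p [zp [zl zc]]]]] := reach gen d_gt0 genx tP suppt.
rewrite (supported_bottom_unique gen d_gt0 genx z0' z0 suppz' suppz) in zp zl zc.
move: zl; case: (shortenP zp) => q zq uq qp zl.
(* The walk is shortened to a simple path, whose tiles all occur in the original one, so the bound
   on [I] persists. *)
exists q; split=> // s; rewrite inE => /orP[/eqP->|/qp sp]; apply: zc.
  exact: mem_head.
by rewrite inE sp orbT.
Qed.
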